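(* Let $A$ be a finite set of non-zero points of the Minkowski space $\mathbb{M}_Z^n$. The star joining the origin $o$ to the points of $A$ is an SMT of $A\cup\{o\}$ if and only if for every subset $B\subseteq A$ of size at most $4$ the star joining $o$ to the points of $B$ is an SMT of $B\cup\{o\}$.
   Context: A Minkowski space $\mathbb{M}^n$ is an $n$-dimensional real normed space $(\mathbb{R}^n,\|\cdot\|)$. A Steiner tree of a finite set $N\subset\mathbb{M}^n$ is a finite tree $T$ whose vertex set $V(T)$ is a finite set of points of $\mathbb{M}^n$ with $N\subseteq V(T)$; its length is $\ell(T)=\sum_{xy\in E(T)}\|x-y\|$. A Steiner minimal tree (SMT) of $N$ is a Steiner tree of $N$ of minimum length. The star joining a point $p$ to a finite set of points is the tree whose edges join $p$ to each of these points (and with no other edges). $\mathbb{M}^n_Z$ denotes $\mathbb{R}^n$ with the norm whose unit ball is $\operatorname{conv}([0,1]^n\cup[-1,0]^n)$. *)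

(* Defs.v *)
From HB Require Import structures.
From mathcomp Require Import all_boot all_order all_algebra finmap.
From mathcomp Require Import all_classical all_reals all_analysis.

Set Implicit Arguments.
Unset Strict Implicit.
Unset Printing Implicit Defensive.

Import Order.TTheory GRing.Theory Num.Theory.

Local Open Scope ring_scope.

Definition conv_hull (R : realType) (M : lmodType R) (S : set M) : set M :=
  smallest (@convex_set R M) S.

Definition gauge (R : realType) (M : lmodType R) (K : set M) (x : M) : R :=
  inf [set t : R | 0 < t /\ K (t^-1 *: x)]%classic.

Definition cube (R : realType) (n : nat) (a b : R) : set 'rV[R]_n :=
  [set x | forall i, a <= x 0 i <= b]%classic.

Definition Zball (R : realType) (n : nat) : set 'rV[R]_n :=
  conv_hull (cube 0 1 `|` cube (-1) 0)%classic.

(* Norms are plain functions 'rV[R]_n -> R, since 'rV[R]_n already carries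
   the library's canonical max norm. *)
Definition Znorm (R : realType) (n : nat) : 'rV[R]_n -> R := gauge (@Zball R n).

Record pgraph (P : choiceType) := PGraph {
  verts : {fset P};
  adj : rel verts
}.

Definition is_tree (P : choiceType) (T : pgraph P) : Prop :=
  [/\ symmetric (@adj P T),
      irreflexive (@adj P T),
      (0 < #|` verts T|)%N,
      (forall x y : verts T, connect (@adj P T) x y)
    & (* as the graph is simple, its cycles are the ucycles of size >= 3 *)
      (forall c : seq (verts T), ucycle (@adj P T) c -> (size c < 3)%N)].

(* The factor 1/2 is there because each edge xy is summed as (x, y) and (y, x). *)
Definition tlength (R : realType) (n : nat) (nm : 'rV[R]_n -> R)
    (T : pgraph 'rV[R]_n) : R :=
  2^-1 * \sum_(x : verts T) \sum_(y : verts T | adj x y) nm (val x - val y).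

Definition steiner_tree (P : choiceType) (N : {fset P}) (T : pgraph P) : Prop :=
  is_tree T /\ (N `<=` verts T)%fset.

Definition is_SMT (R : realType) (n : nat) (nm : 'rV[R]_n -> R)
    (N : {fset 'rV[R]_n}) (T : pgraph 'rV[R]_n) : Prop :=
  steiner_tree N T /\
  forall T' : pgraph 'rV[R]_n, steiner_tree N T' -> tlength nm T <= tlength nm T'.

Definition star (P : choiceType) (p : P) (A : {fset P}) : pgraph P :=
  @PGraph P (p |` A)%fset
    [rel x y | (x != y) && ((val x == p) || (val y == p))].

(* Main.v *)
Require Import Defs.
From HB Require Import structures.
From mathcomp Require Import all_boot all_order all_algebra finmap.
From mathcomp Require Import all_classical all_reals all_analysis.
From mathcomp Require Import lra.

Set Implicit Arguments.
Unset Strict Implicit.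
Unset Printing Implicit Defensive.

Import Order.TTheory GRing.Theory Num.Theory.

Local Open Scope ring_scope.

(** With a further coordinate equal to 0 the Z-norm of x is max x - min x, so
    its norming functionals at x include all x_a - x_b with a a top and b a
    bottom coordinate of x.  Say that t precedes s if some bottom coordinate of
    t is a top coordinate of s; functionals of t and s can then be chosen whose
    sum telescopes to x_a - x_b again, with a top for t and b bottom for s.

    A Steiner tree, rooted at 0, is contracted leaf by leaf.  Each vertex carries
    a cluster of points of A, calibrated either by functionals with sum 0, or by
    functionals with sum x_a - x_b for every top a of some s and every bottom b
    of some t in the cluster.  Two clusters (s1, t1) and (s2, t2) merge if t1
    precedes s2 or t2 precedes s1, and a cluster in which t precedes s has
    functionals with sum 0.  So the contraction is only blocked by points
    s1, t1, s2, t2 among which neither t1 nor t2 precedes s1 or s2, and in this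
    case the star of these at most four points is not minimal: move along the
    indicator of the tops of s1 and s2, then split towards s1, t1 and s2, t2. *)

(** * Trees built from a root by attaching leaves *)

Section GrowingTrees.

Variable P : choiceType.
Implicit Types (r a b x y : P) (es : seq (P * P)) (V : {fset P}).

Definition span r es : seq P := r :: unzip1 es.

(* Edges are pairs (child, parent), the last one attached coming first. *)
Fixpoint growing r es : bool :=
  if es is e :: es' then
    [&& e.1 \notin span r es', e.2 \in span r es' & growing r es']
  else true.

Definition edge es : rel P := [rel x y | ((x, y) \in es) || ((y, x) \in es)].

Definition graph_on V (e : rel P) : pgraph P :=
  PGraph (fun x y : V => e (val x) (val y)).

Lemma edge_sym es : symmetric (edge es).
Proof. by move=> x y; rewrite /edge /= orbC. Qed.

Lemma edge_cons b a es x y :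
  edge ((b, a) :: es) x y =
  [|| (x == b) && (y == a), (y == b) && (x == a) | edge es x y].
Proof. by rewrite /edge /= !inE !xpair_eqE; do ![case: (_ == _)]; rewrite //= ?orbT. Qed.

Lemma growing_uniq r es : growing r es -> uniq (span r es).
Proof.
elim: es => //= -[b a] es IH /= /and3P[bS _ /IH] /= /andP[rN ->].
by move: bS; rewrite /span !inE negb_or => /andP[nbr ->]; rewrite eq_sym (negPf nbr) rN.
Qed.

Lemma edge_span r es x y :
  growing r es -> edge es x y -> (x \in span r es) && (y \in span r es).
Proof.
elim: es => //= -[b a] es IH /and3P[/= bS aS g]; rewrite edge_cons.
have sub z : z \in span r es -> z \in span r ((b, a) :: es).
  by rewrite /span /= !inE => /orP[->//|->]; rewrite !orbT.
case/or3P => [/andP[/eqP-> /eqP->]|/andP[/eqP-> /eqP->]|/(IH g)/andP[xS yS]].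
- by rewrite (sub a) // /span /= !inE eqxx orbT.
- by rewrite (sub a) // /span /= !inE eqxx orbT.
- by rewrite !sub.
Qed.

Lemma edge_leaf r b a es y : growing r ((b, a) :: es) ->
  edge ((b, a) :: es) b y -> y = a.
Proof.
move=> /= /and3P[/= bS aS g]; rewrite edge_cons.
case/or3P => [/andP[_ /eqP//]|/andP[_ /eqP ba]|/(edge_span g)/andP[]].
- by rewrite ba aS in bS.
- by rewrite (negPf bS).
Qed.

Lemma edge_irr r es : growing r es -> irreflexive (edge es).
Proof.
elim: es => // -[b a] es IH g x; have /= /and3P[/= bS aS g'] := g.
rewrite edge_cons IH // orbF orbb; apply/negP => /andP[/eqP xb /eqP xa].
by rewrite -xb xa aS in bS.
Qed.

(** A cycle of length at least 3 through the last leaf [b] would meet its only neighbour [a] twice;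
    any other cycle uses earlier edges only. *)
Lemma edge_acyclic r es (c : seq P) :
  growing r es -> uniq c -> cycle (edge es) c -> (size c < 3)%N.
Proof.
elim: es c => [|[b a] es IH] c g uc cc.
  by case: c cc {uc} => [|x [|y c]].
have [/rot_to[i c' ec]|bc] := boolP (b \in c); last first.
  have /= /and3P[_ _ g'] := g; apply: (IH) => //.
  apply: (sub_in_cycle (P := predC1 b)) cc => [x y|]; last first.
    by apply/allP => x xc; apply: contraNneq bc => <-.
  by rewrite !inE edge_cons => /negPf-> /negPf->.
rewrite -(size_rot i) ec; rewrite -(rot_cycle i) ec in cc.
rewrite -(rot_uniq i) ec in uc.
case: c' {ec} cc uc => [|y [|z c']] //= /and3P[/(edge_leaf g) ya _].
rewrite rcons_path => /andP[_]; rewrite edge_sym => /(edge_leaf g) la.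
by rewrite ya -la mem_last andbF.
Qed.

(** The edges [es0] of the graph stay fixed while the induction peels [es]. *)
Lemma span_connect V r es0 es (rV : r \in V) :
  {subset es <= es0} -> growing r es -> {subset span r es <= V} ->
  forall x : V, val x \in span r es ->
  connect (@adj P (graph_on V (edge es0))) [` rV]%fset x.
Proof.
elim: es => [|[b a] es IH] /= sub g sV x.
  by rewrite inE => /eqP xr; apply/eq_connect0/val_inj.
move: g => /and3P[/= bS aS g].
have sV1 : {subset span r es <= V}.
  move=> z; rewrite /span inE => /orP[/eqP->//|zs].
  by apply: sV; rewrite !inE zs !orbT.
have sub1 : {subset es <= es0} by move=> z zs; apply: sub; rewrite inE zs orbT.
rewrite /span !inE orbCA => /orP[/eqP xb|xs]; last exact: IH.
have aV := sV1 _ aS.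
apply: connect_trans (IH sub1 g sV1 [` aV]%fset aS) (connect1 _).
by rewrite /= xb; apply/orP; right; apply: sub; rewrite inE eqxx.
Qed.

Lemma growing_tree V r es :
  growing r es -> V =i span r es -> is_tree (graph_on V (edge es)).
Proof.
move=> g VS; have rV : r \in V by rewrite VS inE eqxx.
have sym : symmetric (@adj P (graph_on V (edge es))).
  by move=> x y; apply: edge_sym.
split=> //.
- by move=> x; apply: (edge_irr g).
- by rewrite cardfs_gt0; apply/fset0Pn; exists r.
- have sV : {subset span r es <= V} by move=> z; rewrite VS.
  have con (x : V) : connect (@adj P (graph_on V (edge es))) [` rV]%fset x.
    by apply: (@span_connect V r es es) => //; rewrite -VS; apply: valP.
  move=> x y; apply: connect_trans (con y).
  by rewrite (sym_connect_sym sym); apply: con.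
- move=> c /andP[cc uc]; rewrite -(size_map val).
  apply: (edge_acyclic g); first by rewrite map_inj_uniq //; apply: val_inj.
  by rewrite cycle_map.
Qed.

End GrowingTrees.

(** * Growing sequences that span a connected graph *)

Lemma span_map (P Q : choiceType) (f : Q -> P) (r : Q) (es : seq (Q * Q)) :
  span (f r) [seq (f e.1, f e.2) | e <- es] = map f (span r es).
Proof. by rewrite /span /= /unzip1 -!map_comp. Qed.

Lemma growing_map (P Q : choiceType) (f : Q -> P) (r : Q) (es : seq (Q * Q)) :
  injective f -> growing r es -> growing (f r) [seq (f e.1, f e.2) | e <- es].
Proof.
move=> fI; elim: es => // e es IH /= /and3P[e1 e2 /IH ->].
by rewrite span_map !mem_map // e1 e2.
Qed.

(** While a vertex is missing, a path from [r] to it leaves the span along some edge, which attaches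
    a new leaf; [#|V| - 1] edges exhaust [V]. *)
Lemma connected_growing (V : finType) (e : rel V) (r : V) :
  (forall x, connect e r x) ->
  exists es, [/\ growing r es, forall x, x \in span r es
    & forall p, p \in es -> e p.2 p.1].
Proof.
move=> con.
suff /(_ #|V|.-1)[|es [g szes ees]] : forall k, (k < #|V|)%N -> exists es,
    [/\ growing r es, size es = k & forall p, p \in es -> e p.2 p.1].
- by rewrite prednK //; apply/card_gt0P; exists r.
- exists es; split=> // x; rewrite -[_ \in _](mem_enum (mem (span r es))).
  have /eqP/setP : [set x in span r es]%SET == [set: V]%SET.
    rewrite eqEcard finset.subsetT cardsT cardsE /= (card_uniqP (growing_uniq g)).
    by rewrite /= size_map szes prednK //; apply/card_gt0P; exists r.
  by move=> /(_ x); rewrite !inE mem_enum.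
elim=> [_|k IH kV]; first by exists [::].
have [es [g szes ees]] := IH (ltnW kV).
have [x xS] : exists x, x \notin span r es.
  apply/existsP; apply: contraLR kV; rewrite negb_exists -leqNgt => /forallP allS.
  rewrite -szes -(size_map fst es) -[(size _).+1]/(size (span r es)).
  rewrite -(card_uniqP (growing_uniq g)); apply/subset_leq_card/fintype.subsetP => x _.
  by have := allS x; rewrite negbK.
have [y [z [yS zS eyz]]] : exists y z,
    [/\ y \in span r es, z \notin span r es & e y z].
  have /connectP[p ep xl] := con x.
  have : r \in span r es by rewrite inE eqxx.
  elim: p {1 2 3}r ep xl => [|z p IHp] y /= ep xl yS; first by rewrite xl yS in xS.
  move: ep => /andP[eyz ep].
  have [zS|zS] := boolP (z \in span r es); first exact: IHp ep xl zS.
  by exists y, z.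
exists ((z, y) :: es); split; [exact/and3P|by rewrite /= szes|].
by move=> q; rewrite inE => /orP[/eqP->//|/ees].
Qed.

Lemma tree_growing (P : choiceType) (T : pgraph P) (r : verts T) :
  (forall x y, connect (@adj P T) x y) ->
  exists es, [/\ growing (val r) es, verts T =i span (val r) es
    & forall e, e \in es -> exists x y : verts T, e = (val x, val y) /\ adj y x].
Proof.
move=> con; have [es [g ful ees]] := connected_growing (con r).
exists [seq (val e.1, val e.2) | e <- es]; split.
- exact: growing_map val_inj g.
- move=> x; rewrite span_map; apply/idP/mapP => [xT|[y _ ->]]; last exact: valP.
  by exists [` xT]%fset.
- by move=> _ /mapP[p /ees ep ->]; exists p.1, p.2.
Qed.

(** * Lengths of growing sequences and minimality of stars *)

Section Lengths.

Variables (R : realType) (n : nat) (nm : 'rV[R]_n -> R).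
Hypothesis nmN : forall x, nm (- x) = nm x.
Hypothesis nm_ge0 : forall x, 0 <= nm x.

Notation P := 'rV[R]_n.
Implicit Types (r x y : P) (es : seq (P * P)) (A B N V : {fset P}).

Definition elen es : R := \sum_(e <- es) nm (e.1 - e.2).

Lemma elen_cons e es : elen (e :: es) = nm (e.1 - e.2) + elen es.
Proof. by rewrite /elen big_cons. Qed.

Lemma nmC x y : nm (x - y) = nm (y - x).
Proof. by rewrite -nmN opprB. Qed.

Lemma sum_pair V (a b : P) (F : P -> P -> R) : a \in V -> b \in V ->
  \sum_(x : V) \sum_(y : V | (val x == a) && (val y == b)) F (val x) (val y) =
  F a b.
Proof.
move=> aV bV; rewrite pair_big_dep /=.
by rewrite (big_pred1 ([` aV]%fset, [` bV]%fset)) // => -[x y].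
Qed.

Lemma edge_length V r es : growing r es -> {subset span r es <= V} ->
  \sum_(x : V) \sum_(y : V | edge es (val x) (val y)) nm (val x - val y) =
  2 * elen es.
Proof.
elim: es => [_ _|[b a] es IH g sV].
  rewrite /elen big_nil mulr0; apply: big1 => x _.
  by rewrite big_pred0 // => y; rewrite /edge.
have /= /and3P[bS aS g'] := g.
have sV' : {subset span r es <= V}.
  by move=> z; rewrite /span inE => zs; apply: sV; rewrite /span !inE orbCA zs orbT.
have bV : b \in V by apply: sV; rewrite /span !inE eqxx orbT.
rewrite elen_cons mulrDr -IH // mulr2n mulrDl !mul1r /=.
rewrite -{1}(@sum_pair V b a (fun x y => nm (x - y)) bV (sV' _ aS)).
rewrite nmC -(@sum_pair V a b (fun x y => nm (x - y)) (sV' _ aS) bV).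
rewrite -!big_split; apply: eq_bigr => x _ /=.
rewrite [LHS]big_mkcond [X in _ = X + _ + _]big_mkcond.
rewrite [X in _ = _ + X + _]big_mkcond [X in _ = _ + X]big_mkcond.
rewrite -!big_split; apply: eq_bigr => y _ /=; rewrite edge_cons.
have nab : b != a by apply: contraNneq bS => ->.
have bE z : edge es b z = false.
  by apply/negP => /(edge_span g')/andP[]; rewrite (negPf bS).
have bE' z : edge es z b = false by rewrite edge_sym bE.
have [->|xb] := eqVneq (val x) b.
  by rewrite (negPf nab) /= bE andbF !orbF !addr0.
have [->|yb] /= := eqVneq (val y) b; last by rewrite andbF !add0r.
by rewrite bE' orbF andbT addr0 add0r.
Qed.

Lemma tlength_graph_on V r es : growing r es -> {subset span r es <= V} ->
  tlength nm (graph_on V (edge es)) = elen es.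
Proof.
by move=> g sV; rewrite /tlength (edge_length g sV) mulrA mulVf ?mul1r.
Qed.

(** The edges of a spanning growing sequence are edges of [T], and norms are nonnegative, so the
    double sums compare term by term. *)
Lemma growing_le_tlength (T : pgraph P) r : is_tree T -> r \in verts T ->
  exists es, [/\ growing r es, verts T =i span r es & elen es <= tlength nm T].
Proof.
move=> [sym _ _ con _] rT.
have [es [g VS ees]] := tree_growing [` rT]%fset con.
exists es; split => //; rewrite -(@ler_pM2l _ 2) // /tlength mulrA divff // mul1r.
rewrite -(edge_length (V := verts T) g) => [|x]; last by rewrite VS.
apply: ler_sum => x _; rewrite [leLHS]big_mkcond [leRHS]big_mkcond; apply: ler_sum => y _ /=.
case: ifP => [exy|_]; last by case: ifP.
suff -> : adj x y by [].
case/orP: exy => /ees[u [v [[xu yv] a]]].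
  by rewrite (val_inj xu) (val_inj yv) sym.
by rewrite (val_inj xu) (val_inj yv).
Qed.

(** If [y] is a vertex already, nothing is attached; hence an inequality for the length. *)
Lemma growing_leaf r es x y : growing r es -> x \in span r es ->
  exists es', [/\ growing r es', {subset y :: span r es <= span r es'}
    & elen es' <= elen es + nm (y - x)].
Proof.
move=> g xS; have [yS|yS] := boolP (y \in span r es).
  exists es; split=> //; last by rewrite lerDl.
  by move=> z; rewrite inE => /orP[/eqP->|].
exists ((y, x) :: es); split; [exact/and3P| |by rewrite elen_cons addrC].
by move=> z; rewrite /span /= !inE orbCA.
Qed.

Lemma growing_leaves r es (s : seq P) : growing r es ->
  exists es', [/\ growing r es', {subset s ++ span r es <= span r es'}
    & elen es' <= elen es + \sum_(y <- s) nm (y - r)].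
Proof.
move=> g; elim: s => [|y s [es1 [g1 s1 l1]]].
  by exists es; split; rewrite // big_nil addr0.
have rS : r \in span r es1 by rewrite inE eqxx.
have [es2 [g2 s2 l2]] := growing_leaf y g1 rS.
exists es2; split => //.
- move=> z; rewrite inE => /orP[/eqP->|/s1 zs]; apply: s2; first by rewrite inE eqxx.
  by rewrite inE zs orbT.
- by rewrite big_cons (le_trans l2) // [nm _ + _]addrC addrA lerD2r.
Qed.

Definition star_edges A : seq (P * P) := [seq (x, 0) | x <- A].

Lemma star_graph_on A : 0 \notin A ->
  star 0 A = graph_on (0 |` A)%fset (edge (star_edges A)).
Proof.
move=> A0; rewrite /star /graph_on; congr PGraph.
have mem x y : ((x, y) \in star_edges A) = (x \in A) && (y == 0).
  apply/mapP/andP => [[z zA [-> ->]]//|[xA /eqP->]]; by exists x.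
have vA (z : (0 |` A)%fset) : (val z \in A) = (val z != 0).
  have := valP z; rewrite !inE; case: eqVneq => [->|] //=.
  by rewrite (negPf A0).
apply/funext => x; apply/funext => y; rewrite /edge /= !mem !vA.
rewrite -(inj_eq val_inj) /=; move: (fsval x) (fsval y) => u v.
have [->|u0] := eqVneq u 0; first by rewrite /= !andbT eq_sym.
by have [->|] := eqVneq v 0; rewrite ?andbF ?u0.
Qed.

Lemma span_star_edges A : span 0 (star_edges A) = 0 :: A.
Proof. by rewrite /span /unzip1 -map_comp map_id. Qed.

Lemma elen_star_edges A : elen (star_edges A) = \sum_(x <- A) nm x.
Proof. by rewrite /elen big_map; apply: eq_bigr => x _ /=; rewrite subr0. Qed.

Lemma growing_star_edges A : 0 \notin A -> growing 0 (star_edges A).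
Proof.
move=> A0; have := fset_uniq A; rewrite /star_edges.
have : 0 \notin (A : seq P) by [].
elim: (A : seq P) => //= x s IH; rewrite inE negb_or => /andP[x0 s0] /andP[xs us].
rewrite IH // /span /unzip1 -map_comp map_id !inE eqxx negb_or xs andbT.
by rewrite eq_sym x0.
Qed.

(** Trades Steiner trees for growing sequences rooted at 0: a sequence is a tree of the same length,
    and a tree contains a spanning sequence that is no longer. *)
Lemma star_SMTP A : 0 \notin A ->
  is_SMT nm (A `|` [fset 0])%fset (star 0 A) <->
  (forall es, growing 0 es -> {subset A <= span 0 es} ->
     \sum_(x <- A) nm x <= elen es).
Proof.
move=> A0; have g := growing_star_edges A0.
have VS : (0 |` A)%fset =i span 0 (star_edges A).
  by move=> x; rewrite span_star_edges !inE.
have sV : {subset span 0 (star_edges A) <= (0 |` A)%fset} by move=> x; rewrite VS.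
rewrite /is_SMT star_graph_on // (tlength_graph_on g sV) elen_star_edges.
split=> [[_ min] es ges sA|min].
  pose V := [fset x in span 0 es]%fset.
  have VS' : V =i span 0 es by move=> x; rewrite !inE.
  rewrite -(tlength_graph_on ges (V := V)) => [|x]; last by rewrite VS'.
  apply: min; split; first exact: growing_tree ges VS'.
  apply/fsubsetP => x; rewrite VS' => /fsetUP[/sA//|].
  by rewrite inE => /eqP->; rewrite inE eqxx.
split; first split; first exact: growing_tree g VS.
  by rewrite /= fsetUC.
move=> T [tT /fsubsetP sT].
have T0 : 0 \in verts T by apply: sT; rewrite !inE eqxx orbT.
have [es [ges VS' /(le_trans _)]] := growing_le_tlength tT T0; apply.
by apply: min => // x xA; rewrite -VS'; apply: sT; rewrite inE xA.
Qed.

Lemma sum_fsetU_disjoint A B : [disjoint A & B]%fset ->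
  \sum_(x <- (A `|` B)%fset) nm x = \sum_(x <- A) nm x + \sum_(x <- B) nm x.
Proof.
move=> /fdisjointP dis; rewrite -big_cat /=; apply: perm_big; apply: uniq_perm.
- exact: fset_uniq.
- rewrite cat_uniq !fset_uniq andbT /=; apply/hasPn => x xB.
  by apply/negP => /dis; rewrite xB.
- by move=> x; rewrite mem_cat inE.
Qed.

(** A shorter tree for [B], completed by edges from 0 to the rest of [A], would beat the star of
    [A]. *)
Lemma star_SMT_sub A B : 0 \notin A -> (B `<=` A)%fset ->
  is_SMT nm (A `|` [fset 0])%fset (star 0 A) ->
  is_SMT nm (B `|` [fset 0])%fset (star 0 B).
Proof.
move=> A0 sBA.
have B0 : 0 \notin B by apply: contra A0; apply: (fsubsetP sBA).
rewrite !star_SMTP // => min es g sB.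
have [es' [g' s' l']] := growing_leaves (A `\` B)%fset g.
have dis : [disjoint B & A `\` B]%fset.
  by apply/fdisjointP => x xB; rewrite in_fsetD xB.
rewrite -(lerD2r (\sum_(x <- (A `\` B)%fset) nm x)) -sum_fsetU_disjoint //.
have -> : (B `|` (A `\` B) = A)%fset by rewrite fsetUDl fsetDv fsetD0; apply/fsetUidPr.
under [X in _ <= _ + X]eq_bigr do rewrite -[X in nm X]subr0.
apply: le_trans l'; apply: min => // x xA; apply: s'; rewrite mem_cat.
have [xB|xB] := boolP (x \in B); first by rewrite sB ?orbT.
by rewrite in_fsetD xA xB.
Qed.

End Lengths.

(** * The Z-norm as an oscillation *)

Section ZNorm.

Variables (R : realType) (n : nat).
Notation P := 'rV[R]_n.
Implicit Types (x y z : P) (a b c : option 'I_n) (f g : option 'I_n -> R).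

(* Adding a coordinate [None] equal to 0 turns the Z-norm into max - min:
   it is the seminorm of oscillation on R^(n+1) modulo the constants. *)
Definition coord x a : R := if a is Some i then x 0 i else 0.

(** Picks the representative of [f] modulo constants that vanishes at [None]. *)
Definition point f : P := \row_i (f (Some i) - f None).

Lemma coord_point f a : coord (point f) a = f a - f None.
Proof. by case: a => [i|] /=; rewrite ?mxE // subrr. Qed.

Lemma coordB x y a : coord (x - y) a = coord x a - coord y a.
Proof. by case: a => [i|] /=; rewrite ?mxE // subrr. Qed.

Lemma coordD x y a : coord (x + y) a = coord x a + coord y a.
Proof. by case: a => [i|] /=; rewrite ?mxE // addr0. Qed.

Lemma coordN x a : coord (- x) a = - coord x a.
Proof. by case: a => [i|] /=; rewrite ?mxE // oppr0. Qed.

Lemma coordZ t x a : coord (t *: x) a = t * coord x a.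
Proof. by case: a => [i|] /=; rewrite ?mxE // mulr0. Qed.

Lemma coord0 a : coord 0 a = 0.
Proof. by case: a => [i|] //=; rewrite mxE. Qed.

Definition top x a : bool := [forall b, coord x b <= coord x a].
Definition bot x a : bool := [forall b, coord x a <= coord x b].

Lemma exists_top x : exists a, top x a.
Proof.
case: (arg_maxP (coord x) (isT : xpredT (None : option 'I_n))) => a _ max.
by exists a; apply/forallP => b; apply: max.
Qed.

Lemma exists_bot x : exists a, bot x a.
Proof.
case: (arg_minP (coord x) (isT : xpredT (None : option 'I_n))) => a _ min.
by exists a; apply/forallP => b; apply: min.
Qed.

(** The right-hand side is a convex condition met by both cubes. Conversely, with [v] the least
    coordinate, [x] combines a point of each cube with weights [1 + v] and [- v]. *)
Lemma ZballP x : Zball x <-> forall a b, coord x a - coord x b <= 1.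
Proof.
split=> [|osc].
  apply: (smallest_sub (X := [set x | forall a b, coord x a - coord x b <= 1]))%classic.
    move=> y z t; rewrite !inE /= => yP zP a b.
    rewrite -[conv t y z]/(t%:num *: y + (1 - t%:num) *: z) !coordD !coordZ.
    have t0 : 0 <= t%:num by [].
    have t1 : t%:num <= 1 by [].
    have := ler_wpM2l t0 (yP a b).
    have : 0 <= 1 - t%:num by rewrite subr_ge0.
    move=> /ler_wpM2l/(_ _ _ (zP a b)); lra.
  by move=> y /= [] cy [i|] [j|] /=; rewrite ?subr0 ?sub0r ?subrr //;
    try have := cy i; try have := cy j; lra.
have [a /forallP ta] := exists_top x; have [b /forallP tb] := exists_bot x.
have := osc a b; have := ta None; have := tb None => /= b0 a0 ab.
move: (coord x a) (coord x b) ta tb b0 a0 ab => u v ta tb v0 u0 uv.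
have mem (y : P) : ((cube 0 1 `|` cube (-1) 0) y -> Zball y)%classic.
  exact: sub_gen_smallest.
(* If one of the weights [- v] and [1 + v] vanishes, [x] itself lies in one cube. *)
have [v0'|vn0] := eqVneq v 0.
  by apply: mem; left => i; move: (ta (Some i)) (tb (Some i)) => /=; lra.
have [v1|vn1] := eqVneq v (- 1).
  by apply: mem; right => i; move: (ta (Some i)) (tb (Some i)) => /=; lra.
have vlt0 : 0 < - v by rewrite oppr_gt0 lt_neqAle vn0.
have vgt1 : 0 < 1 + v by rewrite -ltrBlDl sub0r lt_neqAle eq_sym vn1 /=; lra.
(* The positive part of [x] has entries in [0, 1 + v] and the negative part
   has entries in [v, 0]. *)
pose p : P := (1 + v)^-1 *: \row_i Num.max (x 0 i) 0.
pose m : P := (- v)^-1 *: \row_i Num.min (x 0 i) 0.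
have pZ : (p \in @Zball R n)%classic.
  rewrite inE; apply: mem; left => i; rewrite !mxE.
  rewrite mulr_ge0 ?invr_ge0 ?le_max ?lexx ?orbT ?(ltW vgt1) //=.
  rewrite mulrC ler_pdivrMr // mul1r ge_max; move: (ta (Some i)) => /=; lra.
have mZ : (m \in @Zball R n)%classic.
  rewrite inE; apply: mem; right => i; rewrite !mxE mulrC.
  rewrite ler_pdivrMr // mul0r ge_min lexx orbT andbT.
  rewrite ler_pdivlMr // le_min; move: (tb (Some i)) => /=; lra.
have le1 : - v <= 1 by lra.
have cvx : @convex_set R P (@Zball R n).
  move=> y z t; rewrite !inE => yZ zZ A [cA sA].
  have /set_mem := cA y z t (mem_set (yZ A (conj cA sA))) (mem_set (zZ A (conj cA sA))).
  exact.
have := cvx _ _ (Itv01 (ltW vlt0) le1) mZ pZ; rewrite inE.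
set q := conv _ _ _; suff -> : q = x by [].
rewrite /q -[LHS]/((- v) *: m + (1 - - v) *: p) opprK !scalerA.
rewrite !divff ?gt_eqF // !scale1r; apply/rowP => i; rewrite !mxE.
by rewrite addrC addr_max_min addr0.
Qed.

Lemma ZnormE x a b : top x a -> bot x b -> Znorm x = coord x a - coord x b.
Proof.
move=> /forallP ta /forallP tb; rewrite /Znorm /gauge.
have r0 : 0 <= coord x a - coord x b by rewrite subr_ge0.
have setP t : 0 < t -> Zball (t^-1 *: x) <-> coord x a - coord x b <= t.
  move=> t0; rewrite ZballP; split=> [/(_ a b)|le c d];
    rewrite !coordZ -mulrBr mulrC ler_pdivrMr // mul1r //.
  by apply: le_trans le; apply: lerB.
set S := [set _ | _]%classic.
have lb : lbound S (coord x a - coord x b).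
  by move=> t [t0 /setP]; apply.
apply/eqP; rewrite eq_le; apply/andP; split.
  (* The slack [e] is there because [t > 0] keeps the value 0 out of [S] when [x = 0]. *)
  apply/ler_addgt0Pr => e e0; apply: ge_inf; first by exists (coord x a - coord x b).
  by split; [lra|apply/setP; lra].
apply: lb_le_inf => //; exists (coord x a - coord x b + 1).
by split; [lra|apply/setP; lra].
Qed.

Lemma Znorm_ge x a b : coord x a - coord x b <= Znorm x.
Proof.
have [c tc] := exists_top x; have [d bd] := exists_bot x.
by rewrite (ZnormE tc bd) lerB //; [apply: (forallP tc)|apply: (forallP bd)].
Qed.

Lemma Znorm_le x (t : R) : (forall a b, coord x a - coord x b <= t) -> Znorm x <= t.
Proof.
have [c tc] := exists_top x; have [d bd] := exists_bot x.
by rewrite (ZnormE tc bd).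
Qed.

Lemma Znorm_ge0 x : 0 <= Znorm x.
Proof. by have := Znorm_ge x None None; rewrite subrr. Qed.

Lemma ZnormN x : Znorm (- x) = Znorm x.
Proof.
apply/eqP; rewrite eq_le; apply/andP; split; apply: Znorm_le => a b.
  by have := Znorm_ge x b a; rewrite !coordN; lra.
by have := Znorm_ge (- x) b a; rewrite !coordN; lra.
Qed.

Lemma top_bot_neq x a : x != 0 -> top x a -> ~~ bot x a.
Proof.
move=> + /forallP ta; apply: contra => /forallP ba.
have e b : coord x b = coord x a by apply/eqP; rewrite eq_le ta ba.
by apply/eqP/rowP => i; rewrite mxE -[LHS]/(coord x (Some i)) e -(e None).
Qed.

End ZNorm.

(** * Shortening the star of four unlinked points *)

Section FourPoints.

Variables (R : realType) (n : nat).
Notation P := 'rV[R]_n.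
Notation nm := (@Znorm R n).
Notation Znorm_ge0 := (@Znorm_ge0 R n).
Implicit Types (x s t u : P) (a b c : option 'I_n) (f g : option 'I_n -> R) (e d : R).

Definition precedes t s : bool := [exists c, bot t c && top s c].

Lemma coord_gap x : exists2 d, 0 < d &
  forall a b, coord x a < coord x b -> coord x a + d <= coord x b.
Proof.
pose d := \big[Num.min/1]_(p : option 'I_n * option 'I_n | coord x p.1 < coord x p.2)
  (coord x p.2 - coord x p.1).
exists d => [|a b ab].
  by apply/bigmin_gtP; split=> // p; rewrite subr_gt0.
by rewrite addrC -lerBrDr; apply: (@bigmin_le_cond _ _ _ _ (a, b)).
Qed.

(* First-order decrease of the norm when [x] moves to [x - e f]: the minimum
   of [f] over the top coordinates minus its maximum over the bottom ones. *)
Lemma Znorm_shift x d e f (m M : R) :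
  (forall a b, coord x a < coord x b -> coord x a + d <= coord x b) ->
  0 <= e -> 2 * e <= d -> (forall a, 0 <= f a <= 2) -> 0 <= M -> m <= 2 ->
  (forall a, top x a -> m <= f a) -> (forall a, bot x a -> f a <= M) ->
  nm (x - e *: point f) <= nm x - e * (m - M).
Proof.
move=> gap e0 ed f02 M0 m2 topf botf.
have [p tp] := exists_top x; have [q bq] := exists_bot x.
(* A coordinate that is not a top one starts at least [d >= 2 * e] below the maximum; as [f >= 0]
   and [m <= 2], it stays below the bound. *)
have up a : coord x a - e * f a <= coord x p - e * m.
  have [ta|] := boolP (top x a).
    have := ler_wpM2l e0 (topf _ ta); have := forallP tp a; lra.
  rewrite negb_forall => /existsP[b]; rewrite -ltNge => /gap ab.
  have /andP[f0 _] := f02 a.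
  have := forallP tp b; have := mulr_ge0 e0 f0; have := ler_wpM2l e0 m2; lra.
have dn a : coord x q - e * M <= coord x a - e * f a.
  have [ba|] := boolP (bot x a).
    have := ler_wpM2l e0 (botf _ ba); have := forallP bq a; lra.
  rewrite negb_forall => /existsP[b]; rewrite -ltNge => /gap ab.
  have /andP[_ f2] := f02 a.
  have := forallP bq b; have := mulr_ge0 e0 M0; have := ler_wpM2l e0 f2; lra.
rewrite (ZnormE tp bq); apply: Znorm_le => a b.
by rewrite !coordB !coordZ !coord_point; have := up a; have := dn b; lra.
Qed.

(** An edge of length at most [e] leads from [e *: point f] to [e *: point h], from which [s] and
    [t] each cost [e] less than their norm: the net gain is [e]. If [s = t], a direct edge gains
    [e]. *)
Lemma branch s t d e f es :
  s != 0 -> t != 0 -> ~~ precedes t s ->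
  (forall x, x \in [:: s; t] ->
    forall a b, coord x a < coord x b -> coord x a + d <= coord x b) ->
  0 <= e -> 2 * e <= d ->
  (forall a, 0 <= f a <= 1) -> (forall a, top s a -> f a = 1) ->
  (forall a, bot t a -> f a = 0) ->
  growing 0 es -> e *: point f \in span 0 es ->
  exists es', [/\ growing 0 es', {subset [fset s; t]%fset <= span 0 es'},
    {subset span 0 es <= span 0 es'}
    & elen nm es' <= elen nm es + \sum_(x <- [fset s; t]%fset) nm x - e].
Proof.
move=> s0 t0 /existsPn nts gap e0 ed f01 f1 f0 g fS.
have f02 a : 0 <= f a <= 2 by have := f01 a; lra.
have [st|nst] := eqVneq s t.
  have [es' [g' s' l']] := growing_leaf Znorm_ge0 s g fS.
  exists es'; split=> //.
  - by move=> x; rewrite -st fsetUid inE => /eqP->; apply: s'; rewrite inE eqxx.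
  - by move=> x xS; apply: s'; rewrite inE xS orbT.
  apply: (le_trans l'); rewrite -addrA lerD2l -st fsetUid big_seq_fset1.
  have -> : nm s - e = nm s - e * (1 - 0) by lra.
  apply: (@Znorm_shift s d e f 1 0) => //.
  - by apply: gap; rewrite inE eqxx.
  - lra.
  - by move=> a /f1->.
  - by rewrite st => a /f0->.
have nbt a : bot t a -> top s a = false.
  by move=> ba; have := nts a; rewrite ba => /negPf.
(* Then [h - f] lies in [0, 1], and from tops to bottoms [h] drops by at least 1, both for [s] (from
   2 to at most 1) and for [t] (from at least 1 to 0). *)
pose h a : R := if top s a then 2 else if bot t a then 0 else 1.
have h02 a : 0 <= h a <= 2 by rewrite /h; case: ifP => _; [|case: ifP => _]; lra.
have [es1 [g1 s1 l1]] := growing_leaf Znorm_ge0 (e *: point h) g fS.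
have hS1 : e *: point h \in span 0 es1 by apply: s1; rewrite inE eqxx.
have [es2 [g2 s2 l2]] := growing_leaf Znorm_ge0 s g1 hS1.
have hS2 : e *: point h \in span 0 es2 by apply: s2; rewrite inE hS1 orbT.
have [es3 [g3 s3 l3]] := growing_leaf Znorm_ge0 t g2 hS2.
exists es3; split=> //.
- move=> x /fset2P[->|->]; apply: s3; last by rewrite inE eqxx.
  by rewrite inE s2 ?orbT // inE eqxx.
- by move=> x xS; apply: s3; rewrite inE s2 ?orbT // inE s1 ?orbT // inE xS orbT.
have {}l1 : elen nm es1 <= elen nm es + e.
  apply: (le_trans l1); rewrite lerD2l; apply: Znorm_le => a b.
  rewrite !coordB !coordZ !coord_point.
  have hf c : 0 <= h c - f c <= 1.
    rewrite /h; case: ifP => [/f1->|_]; first lra.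
    by case: ifP => [/f0->|_]; have := f01 c; lra.
  have /andP[_ /(ler_wpM2l e0) ha] := hf a.
  have /andP[/(ler_wpM2l e0) hb _] := hf b.
  lra.
have {}l2 : elen nm es2 <= elen nm es1 + (nm s - e).
  apply: (le_trans l2); rewrite lerD2l.
  have -> : nm s - e = nm s - e * (2 - 1) by lra.
  apply: (@Znorm_shift s d e h 2 1) => //.
  - by apply: gap; rewrite inE eqxx.
  - by move=> a ta; rewrite /h ta.
  - move=> a ba; rewrite /h; case: ifP => [ta|_]; last by case: ifP.
    by have := top_bot_neq s0 ta; rewrite ba.
have {}l3 : elen nm es3 <= elen nm es2 + (nm t - e).
  apply: (le_trans l3); rewrite lerD2l.
  have -> : nm t - e = nm t - e * (1 - 0) by lra.
  apply: (@Znorm_shift t d e h 1 0) => //.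
  - by apply: gap; rewrite !inE eqxx orbT.
  - lra.
  - move=> a ta; rewrite /h (negPf (top_bot_neq t0 ta)).
    by case: ifP => _; lra.
  - by move=> a ba; rewrite /h (nbt _ ba) ba.
rewrite big_fsetU1 ?inE //= big_seq_fset1; lra.
Qed.

(** The trunk from 0 to [e *: point f] costs at most [e] and each of the two branches saves [e], so
    the star is beaten by at least [e]. *)
Lemma star_not_minimal s1 t1 s2 t2 :
  [/\ s1 != 0, t1 != 0, s2 != 0 & t2 != 0] ->
  [disjoint [fset s1; t1] & [fset s2; t2]]%fset ->
  [/\ ~~ precedes t1 s1, ~~ precedes t2 s2, ~~ precedes t1 s2 & ~~ precedes t2 s1] ->
  exists es, [/\ growing 0 es, {subset ([fset s1; t1] `|` [fset s2; t2])%fset <= span 0 es}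
    & elen nm es < \sum_(x <- ([fset s1; t1] `|` [fset s2; t2])%fset) nm x].
Proof.
move=> [s10 t10 s20 t20] dis [n11 n22 n12 n21].
have [d d0 gap] : exists2 d, 0 < d & forall x, x \in [:: s1; t1; s2; t2] ->
    forall a b, coord x a < coord x b -> coord x a + d <= coord x b.
  elim: [:: _; _; _; _] => [|x l [d d0 gap]]; first by exists 1.
  have [d' d'0 gap'] := coord_gap x.
  exists (Num.min d d'); first by rewrite lt_min d0.
  have m1 : Num.min d d' <= d by rewrite ge_min lexx.
  have m2 : Num.min d d' <= d' by rewrite ge_min lexx orbT.
  move=> y; rewrite inE => /orP[/eqP->|yl] a b ab.
    by have := gap' _ _ ab; lra.
  by have := gap _ yl _ _ ab; lra.
pose e := d / 2; have e0 : 0 < e by rewrite /e; lra.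
have ed : 2 * e <= d by rewrite /e; lra.
(* Both branches need [f] to be 1 on the tops of [s1], [s2] and 0 on the bottoms of [t1], [t2]; the
   four negated relations ensure the latter. *)
pose f a : R := (top s1 a || top s2 a)%:R.
have f01 a : 0 <= f a <= 1 by rewrite /f; case: (_ || _) => /=; lra.
have [es0 [g0 S0 l0]] := growing_leaf Znorm_ge0 (e *: point f) (isT : growing 0 [::])
  (mem_head _ _).
have {}l0 : elen nm es0 <= e.
  apply: (le_trans l0); rewrite /elen big_nil add0r subr0; apply: Znorm_le => a b.
  rewrite !coordZ !coord_point.
  have /andP[_ /(ler_wpM2l (ltW e0)) fa] := f01 a.
  have /andP[/(ler_wpM2l (ltW e0)) fb _] := f01 b.
  lra.
have fS0 : e *: point f \in span 0 es0 by apply: S0; rewrite inE eqxx.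
have f0 t a : ~~ precedes t s1 -> ~~ precedes t s2 -> bot t a -> f a = 0.
  move=> /existsPn/(_ a) h1 /existsPn/(_ a) h2 ba.
  by move: h1 h2; rewrite /f ba /= => /negPf-> /negPf->.
have [es1 [g1 B1 S1 l1]] : exists es', [/\ growing 0 es',
    {subset [fset s1; t1]%fset <= span 0 es'},
    {subset span 0 es0 <= span 0 es'}
    & elen nm es' <= elen nm es0 + \sum_(x <- [fset s1; t1]%fset) nm x - e].
  apply: (@branch s1 t1 d e f) => //.
  - by move=> x xs; apply: gap; move: xs; rewrite !inE => /orP[]->; rewrite ?orbT.
  - exact: ltW.
  - by move=> a ta; rewrite /f ta.
  - by move=> a; apply: f0.
have [es2 [g2 B2 S2 l2]] : exists es', [/\ growing 0 es',
    {subset [fset s2; t2]%fset <= span 0 es'},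
    {subset span 0 es1 <= span 0 es'}
    & elen nm es' <= elen nm es1 + \sum_(x <- [fset s2; t2]%fset) nm x - e].
  apply: (@branch s2 t2 d e f) => //.
  - by move=> x xs; apply: gap; move: xs; rewrite !inE => /orP[]->; rewrite ?orbT.
  - exact: ltW.
  - by move=> a ta; rewrite /f ta orbT.
  - by move=> a; apply: f0.
  - exact: S1.
exists es2; split=> //.
  by move=> x /fsetUP[/B1/S2|/B2].
by rewrite sum_fsetU_disjoint //; lra.
Qed.

End FourPoints.

(** * Lower bound on length by calibration *)

Section Calibration.

Variables (R : realType) (n : nat) (A : {fset 'rV[R]_n}).
Notation P := 'rV[R]_n.
Notation nm := (@Znorm R n).
Implicit Types (s t u v x : P) (a b c : option 'I_n) (d : R) (own : P -> P).

(* For all [a], [b] as below, the functional [coord ^~ a - coord ^~ b] is the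
   sum of norming functionals of the points hanging below [v], and [d] is the
   length spent below [v] minus the norms of these points. *)
Definition path_bound v s t d : Prop :=
  forall a b, top s a -> bot t b -> coord v b - coord v a <= d.

Lemma path_bound_ge0 v s t d : precedes t s -> path_bound v s t d -> 0 <= d.
Proof. by move=> /existsP[c /andP[bc tc]] /(_ c c tc bc); rewrite subrr. Qed.

Lemma path_bound_cat v s1 t1 s2 t2 d1 d2 : precedes t1 s2 ->
  path_bound v s1 t1 d1 -> path_bound v s2 t2 d2 ->
  path_bound v s1 t2 (d1 + d2).
Proof.
move=> /existsP[c /andP[bc tc]] p1 p2 a b ta bb.
by have := p1 a c ta bc; have := p2 c b tc bb; lra.
Qed.

(** A difference of two coordinates is 1-Lipschitz for the Z-norm. *)
Lemma path_bound_move u v s t d :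
  path_bound u s t d -> path_bound v s t (d + nm (u - v)).
Proof.
move=> pb a b ta bb; have := pb a b ta bb.
by have := Znorm_ge (u - v) a b; rewrite !coordB; lra.
Qed.

Lemma path_bound_le v s t d d' : d <= d' ->
  path_bound v s t d -> path_bound v s t d'.
Proof. by move=> dd' pb a b ta bb; apply: le_trans (pb a b ta bb) dd'. Qed.

(* [own x = v] means that the cluster of the point [x] of [A] has been moved to [v]. *)
Definition calibrated own v d : Prop := 0 <= d \/
  exists s t, [/\ s \in A, t \in A, own s = v, own t = v & path_bound v s t d].

(** The form in which minimality of small stars enters: the blocking configuration of
    [star_not_minimal] does not occur in [A]. *)
Hypothesis linked : forall s1 t1 s2 t2,
  [/\ s1 \in A, t1 \in A, s2 \in A & t2 \in A] ->
  [disjoint [fset s1; t1] & [fset s2; t2]]%fset ->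
  ~~ precedes t1 s1 -> ~~ precedes t2 s2 -> precedes t1 s2 || precedes t2 s1.

(** If one side has a nonnegative balance, for instance because its own [t] precedes its [s], the
    bound of the other side survives. Otherwise [linked] lets the two paths be concatenated in one
    of the two orders. *)
Lemma calibrated_merge own u v d e : u != v ->
  calibrated own u d -> calibrated own v e ->
  calibrated (fun x => if own x == u then v else own x) v (d + nm (u - v) + e).
Proof.
move=> uv cu cv.
have own1 x : own x = u -> (if own x == u then v else own x) = v.
  by move=> ->; rewrite eqxx.
have own2 x : own x = v -> (if own x == u then v else own x) = v.
  by move=> ->; case: ifP.
have zero_l : 0 <= d + nm (u - v) ->
    calibrated (fun x => if own x == u then v else own x) v (d + nm (u - v) + e).
  move=> d0; case: cv => [e0|[s [t [sA tA os ot pb]]]]; first by left; rewrite addr_ge0.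
  right; exists s, t; split; rewrite ?own2 //.
  by apply: path_bound_le pb; rewrite lerDr.
case: cu => [d0|[s1 [t1 [s1A t1A os1 ot1 /(@path_bound_move _ v) pb1]]]].
  by apply: zero_l; rewrite addr_ge0 ?Znorm_ge0.
have [p11|n11] := boolP (precedes t1 s1).
  exact/zero_l/(path_bound_ge0 p11 pb1).
have zero_r : 0 <= e ->
    calibrated (fun x => if own x == u then v else own x) v (d + nm (u - v) + e).
  move=> e0; right; exists s1, t1; split; rewrite ?own1 //.
  by apply: path_bound_le pb1; rewrite lerDl.
case: cv => [/zero_r//|[s2 [t2 [s2A t2A os2 ot2 pb2]]]].
have [p22|n22] := boolP (precedes t2 s2).
  exact/zero_r/(path_bound_ge0 p22 pb2).
have dis : [disjoint [fset s1; t1] & [fset s2; t2]]%fset.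
  apply/fdisjointP => x /fset2P xs; apply/negP => /fset2P ys.
  have ou : own x = u by case: xs => ->.
  have ov : own x = v by case: ys => ->.
  by move: uv; rewrite -ou -ov eqxx.
have /orP[p12|p21] := linked (And4 s1A t1A s2A t2A) dis n11 n22; right.
  exists s1, t2; split; [by []|by []|exact: own1|exact: own2|].
  exact: path_bound_cat p12 pb1 pb2.
exists s2, t1; split; [by []|by []|exact: own2|exact: own1|rewrite addrC].
exact: path_bound_cat p21 pb2 pb1.
Qed.

Lemma calibrated_root own d : calibrated own 0 d -> 0 <= d.
Proof.
move=> [//|[s [t [_ _ _ _ pb]]]].
have [a ta] := exists_top s; have [b bb] := exists_bot t.
by have := pb a b ta bb; rewrite !coord0 subrr.
Qed.

(** Contracting the last leaf [u] into its parent [v] moves the edge length from [elen] into the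
    balance of [v], so the total is unchanged down to the root. *)
Lemma calibrated_fold es own (d : P -> R) : growing 0 es ->
  (forall v, v \in span 0 es -> calibrated own v (d v)) ->
  0 <= elen nm es + \sum_(v <- span 0 es) d v.
Proof.
elim: es own d => [|[u v] es IH] own d g cal.
  rewrite /elen big_nil add0r /span big_seq1.
  by apply: (calibrated_root (own := own)); apply: cal; rewrite inE.
have /and3P[/= uS vS g'] := g.
have uv : u != v by apply: contraNneq uS => ->.
pose d' x := if x == v then d u + nm (u - v) + d v else d x.
have sub x : x \in span 0 es -> x \in span 0 ((u, v) :: es).
  by rewrite /span !inE orbCA => ->; rewrite orbT.
have uS' : u \in span 0 ((u, v) :: es) by rewrite /span !inE eqxx orbT.
have := IH (fun x => if own x == u then v else own x) d' g'.
have -> : \sum_(x <- span 0 es) d' x =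
    \sum_(x <- span 0 es) d x + (d u + nm (u - v)).
  have us := growing_uniq g'.
  rewrite (bigD1_seq v) //= [X in _ = X + _](bigD1_seq v) //= /d' eqxx.
  under eq_bigr => x /negPf xv do rewrite xv.
  lra.
have -> : \sum_(x <- span 0 ((u, v) :: es)) d x = \sum_(x <- span 0 es) d x + d u.
  by rewrite /span /= !big_cons; lra.
rewrite elen_cons => main.
suff : forall x, x \in span 0 es ->
    calibrated (fun x => if own x == u then v else own x) x (d' x).
  by move=> /main /=; lra.
move=> x xS; rewrite /d'; case: eqVneq => [->|xv].
  by apply: calibrated_merge => //; apply: cal => //; apply: sub.
have xu : x != u by apply: contraNneq uS => <-.
case: (cal x (sub x xS)) => [|[s [t [sA tA os ot pb]]]]; [by left|right].
by exists s, t; split=> //; rewrite ?os ?ot (negPf xu).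
Qed.

(** Initially each [v] in [A] is its own cluster, with [s = t = v] and balance [- nm v], the value
    given by its norming functionals; other vertices have balance 0. *)
Lemma linked_star_minimal es : growing 0 es -> {subset A <= span 0 es} ->
  \sum_(x <- A) nm x <= elen nm es.
Proof.
move=> g sA; have := @calibrated_fold es id (fun v => if v \in A then - nm v else 0) g.
rewrite -big_mkcond -big_filter.
have -> : \sum_(v <- [seq v <- span 0 es | v \in A]) - nm v = - \sum_(v <- A) nm v.
  rewrite -sumrN; apply: perm_big; apply: uniq_perm.
  - exact/filter_uniq/growing_uniq.
  - exact: fset_uniq.
  - by move=> x; rewrite mem_filter andb_idr // => /sA.
rewrite subr_ge0; apply=> v _; case: ifP => vA; [right|by left].
exists v, v; split=> // a b ta bb.
by rewrite (ZnormE ta bb); lra.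
Qed.

End Calibration.

(** * Reduction to subsets of at most four points *)

Theorem corollary4 (R : realType) (n : nat) (A : {fset 'rV[R]_n})
    (hA : 0 \notin A) :
  is_SMT (@Znorm R n) (A `|` [fset 0])%fset (star (0 : 'rV[R]_n) A) <->
  (forall B : {fset 'rV[R]_n}, (B `<=` A)%fset -> (#|` B| <= 4)%N ->
     is_SMT (@Znorm R n) (B `|` [fset 0])%fset (star (0 : 'rV[R]_n) B)).
Proof.
split=> [min B sBA _|small].
  exact: (star_SMT_sub (@ZnormN R n) (@Znorm_ge0 R n) hA sBA min).
apply/(star_SMTP (@ZnormN R n) (@Znorm_ge0 R n) hA) => es.
apply: linked_star_minimal => s1 t1 s2 t2 [s1A t1A s2A t2A] dis n11 n22.
(* If both links fail, [star_not_minimal] yields a tree shorter than the star of these points,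
   against [small]. *)
apply: contraT; rewrite negb_or => /andP[n12 n21].
pose B := ([fset s1; t1] `|` [fset s2; t2])%fset.
have sBA : (B `<=` A)%fset.
  by apply/fsubsetP => x /fsetUP[] /fset2P[] ->.
have cardB : (#|` B| <= 4)%N.
  rewrite (leq_trans (leq_addr #|` [fset s1; t1] `&` [fset s2; t2]|%fset _)) //.
  by rewrite cardfsUI !cardfs2; do ![case: (_ != _)].
have B0 : 0 \notin B by apply: contra hA; apply: (fsubsetP sBA).
have neq0 x : x \in A -> x != 0 by move=> xA; apply: contraNneq hA => <-.
have nz := And4 (neq0 _ s1A) (neq0 _ t1A) (neq0 _ s2A) (neq0 _ t2A).
have [es' [g sB lt]] := star_not_minimal nz dis (And4 n11 n22 n12 n21).
have /(star_SMTP (@ZnormN R n) (@Znorm_ge0 R n) B0)/(_ es' g sB) := small B sBA cardB.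
by rewrite leNgt lt.
Qed.
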